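(* Let $A$ and $B$ be two subspaces of $\mathbb{Z}_{p^s}^n$, and let $C$ be a subspace of $\mathbb{Z}_{p^s}^n$ with $\dim(C)=\min\{\dim(A),\dim(B)\}$. Then $\mathrm{ad}(A,B)\leq \mathrm{ad}(A,C)+\mathrm{ad}(C,B)$.
   Context: $p$ is a prime, $s\ge1$, $R=\mathbb{Z}_{p^s}$; vectors are row vectors. A set $\{\alpha_1,\dots,\alpha_k\}\subseteq R^n$ is unimodular if the matrix with rows $\alpha_i$ has a right inverse. For a submodule $V$, $\dim(V)$ is the largest size of a unimodular subset. A $k$-subspace is a submodule with a unimodular basis of $k$ vectors; it is identified with a matrix whose rows form such a basis, and $\begin{pmatrix}X\\ Y\end{pmatrix}$ stacks representations. Inner rank $\rho(M)$: least $r$ with $M=CD$, $C$ having $r$ columns ($\rho(0)=0$). The arithmetic distance is $\mathrm{ad}(X,Y)=\rho\begin{pmatrix}X\\ Y\end{pmatrix}-\max\{\dim(X),\dim(Y)\}$. *)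

(* Defs.v *)
From HB Require Import structures.
From mathcomp Require Export all_boot all_order all_algebra.

Set Implicit Arguments.
Unset Strict Implicit.
Unset Printing Implicit Defensive.

Import Order.TTheory GRing.Theory Num.Theory.
Local Open Scope ring_scope.

Section Defs.

Variable R : finComNzRingType.

Definition has_right_inverse m n (M : 'M[R]_(m, n)) : bool :=
  [exists N : 'M[R]_(n, m), M *m N == 1%:M].

(* The rows are listed in the order of [enum S]; having a right inverse does
   not depend on this order. *)
Definition unimodular n (S : {set 'rV[R]_n}) : bool :=
  has_right_inverse (\matrix_(i < #|S|) (enum_val i : 'rV[R]_n)).

Definition dim n (V : {set 'rV[R]_n}) : nat :=
  \max_(S : {set 'rV[R]_n} | (S \subset V) && unimodular S) #|S|.

Definition row_span k n (M : 'M[R]_(k, n)) : {set 'rV[R]_n} :=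
  [set x *m M | x : 'rV[R]_k].

Definition unimodular_basis n (V : {set 'rV[R]_n}) k (M : 'M[R]_(k, n)) : bool :=
  [&& has_right_inverse M,
      injectiveb (fun x : 'rV[R]_k => x *m M) & row_span M == V].

Definition is_ksubspace n k (V : {set 'rV[R]_n}) : Prop :=
  submod_closed V /\ exists M : 'M[R]_(k, n), unimodular_basis V M.

Record subspace n := Subspace {
  carrier :> {set 'rV[R]_n};
  subspaceP : exists k, is_ksubspace k carrier
}.

Definition factors_through r m n (M : 'M[R]_(m, n)) : bool :=
  [exists C : 'M[R]_(m, r), exists D : 'M[R]_(r, n), M == C *m D].

Lemma ex_factors_through m n (M : 'M[R]_(m, n)) :
  exists r, factors_through r M.
Proof.
by exists m; apply/existsP; exists 1%:M; apply/existsP; exists M; rewrite mul1mx.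
Qed.

(* [r = 0] is allowed, and a product through ['M_(m, 0)] is [0], so the inner
   rank of [0] is [0]. *)
Definition inner_rank m n (M : 'M[R]_(m, n)) : nat :=
  ex_minn (ex_factors_through M).

Lemma subspace_has_basis n (V : subspace n) :
  exists u : {k : nat & 'M[R]_(k, n)}, unimodular_basis V (tagged u).
Proof. by have [k [_ [M HM]]] := subspaceP V; exists (Tagged (fun k => 'M[R]_(k, n)) M). Qed.

(* An arbitrary unimodular basis; [ad_basis] below shows that [ad] does not
   depend on it. *)
Definition subspace_basis n (V : subspace n) : {k : nat & 'M[R]_(k, n)} :=
  xchoose (subspace_has_basis V).

Definition subspace_mx n (V : subspace n) : 'M[R]_(tag (subspace_basis V), n) :=
  tagged (subspace_basis V).

(* Valued in [int] so that the subtraction is not truncated. *)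
Definition ad n (X Y : subspace n) : int :=
  (inner_rank (col_mx (subspace_mx X) (subspace_mx Y)))%:Z
  - (maxn (dim X) (dim Y))%:Z.

Lemma subspace_mxP n (V : subspace n) : unimodular_basis V (subspace_mx V).
Proof. exact: xchooseP (subspace_has_basis V). Qed.

Lemma inner_rank_mull m1 m2 n (P : 'M[R]_(m1, m2)) (M : 'M[R]_(m2, n)) :
  (inner_rank (P *m M) <= inner_rank M)%N.
Proof.
rewrite {2}/inner_rank; case: ex_minnP => r /existsP[C /existsP[D /eqP ->]] _.
rewrite /inner_rank; case: ex_minnP => r' _; apply.
by apply/existsP; exists (P *m C); apply/existsP; exists D; rewrite mulmxA.
Qed.

Lemma unimodular_basis_change n (V : {set 'rV[R]_n}) k l
    (M : 'M[R]_(k, n)) (N : 'M[R]_(l, n)) :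
  unimodular_basis V M -> unimodular_basis V N -> exists P, M = P *m N.
Proof.
move=> /and3P[_ _ /eqP sM] /and3P[_ _ /eqP sN].
have H i : exists x : 'rV[R]_l, row i M == x *m N.
  have : row i M \in row_span N.
    by rewrite sN -sM rowE; apply: imset_f.
  by case/imsetP=> x _ ->; exists x.
exists (\matrix_i xchoose (H i)); apply/row_matrixP => i.
by rewrite row_mul rowK -(eqP (xchooseP (H i))).
Qed.

Lemma inner_rank_basis n (X Y : {set 'rV[R]_n}) k k' l l'
    (M : 'M[R]_(k, n)) (M' : 'M[R]_(k', n))
    (N : 'M[R]_(l, n)) (N' : 'M[R]_(l', n)) :
  unimodular_basis X M -> unimodular_basis X M' ->
  unimodular_basis Y N -> unimodular_basis Y N' ->
  (inner_rank (col_mx M N) <= inner_rank (col_mx M' N'))%N.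
Proof.
move=> bM bM' bN bN'.
have [P ->] := unimodular_basis_change bM bM'.
have [Q ->] := unimodular_basis_change bN bN'.
have -> : col_mx (P *m M') (Q *m N') = block_mx P 0 0 Q *m col_mx M' N'.
  by rewrite mul_block_col !mul0mx addr0 add0r.
exact: inner_rank_mull.
Qed.

Lemma ad_basis n (X Y : subspace n) k l
    (M : 'M[R]_(k, n)) (N : 'M[R]_(l, n)) :
  unimodular_basis X M -> unimodular_basis Y N ->
  ad X Y = (inner_rank (col_mx M N))%:Z - (maxn (dim X) (dim Y))%:Z.
Proof.
move=> bM bN; have bX := subspace_mxP X; have bY := subspace_mxP Y.
rewrite /ad; congr (Posz _ - _); apply/eqP; rewrite eqn_leq.
by rewrite !(inner_rank_basis bX bM bY bN, inner_rank_basis bM bX bN bY).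
Qed.

End Defs.

(* Main.v *)
(** Over a local ring, a right-invertible [c x r] matrix can be completed by
    [r - c] rows so that all rows together span [R^r] (Steinitz exchange: a
    linear combination equal to a unit has a unit coefficient).  Let [U] be a
    unimodular family of [dim C] vectors of [C].  If [(A; C) = P D] with [D]
    having [r] rows, then [U = T D] with [T] right-invertible, so the rows of
    [D] are spanned by [U] and [r - dim C] further vectors; the same holds for
    [(C; B)] with [r'].  Sharing [U], the rows of [(A; B)] are spanned by
    [r + r' - dim C] vectors, which is the inequality
    [rho (A; B) + dim C <= rho (A; C) + rho (C; B)] to which the theorem
    reduces because [dim C = min (dim A) (dim B)]. *)

Require Import Defs.
From mathcomp Require Import zify.

Import Order.TTheory GRing.Theory Num.Theory.
Local Open Scope ring_scope.

Definition local_ring (R : unitRingType) : Prop :=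
  forall x y : R,
    x + y \is a GRing.unit -> x \is a GRing.unit \/ y \is a GRing.unit.

(** An element is a unit exactly when [p] does not divide its representative, and multiples of [p]
    are closed under addition. *)
Lemma local_ring_Zp_primeX (p s : nat) :
  prime p -> (0 < s)%N -> local_ring 'Z_(p ^ s)%N.
Proof.
move=> p_pr s_gt0.
have ps_gt1 : (1 < p ^ s)%N by rewrite -(exp1n s) ltn_exp2r ?prime_gt1.
have unitE (a : nat) : (a%:R : 'Z_(p ^ s)%N) \is a GRing.unit = ~~ (p %| a)%N.
  by rewrite unitZpE // coprime_pexpl ?prime_coprime.
move=> x y; rewrite -(natr_Zp x) -(natr_Zp y) -natrD !unitE => pxy.
case px: (p %| val x)%N; last by left.
by right; apply: contra pxy => py; rewrite dvdn_addr.
Qed.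

Lemma local_ring_sum_unit (R : comUnitRingType) (I : finType) (F : I -> R) :
  local_ring R -> \sum_i F i \is a GRing.unit ->
  exists i, F i \is a GRing.unit.
Proof.
move=> locR; apply: (big_ind (fun x => x \is a GRing.unit ->
  exists i, F i \is a GRing.unit)) => [|x y IHx IHy|i _ uFi].
- by rewrite unitr0.
- by case/locR.
- by exists i.
Qed.

Lemma mulmx_split_ord (R : pzRingType) (m k n : nat) (i : 'I_k.+1)
    (Y : 'M[R]_(m, k.+1)) (Q : 'M[R]_(k.+1, n)) :
  Y *m Q = col i Y *m row i Q + col' i Y *m row' i Q.
Proof.
apply/matrixP => a b; rewrite !mxE (bigD1_ord i) //= big_ord1 !mxE.
by congr (_ + _); apply: eq_bigr => j _; rewrite !mxE.
Qed.

(** Induction on [c]: the rows below the top row [q] have a completion [Q] by induction, and [q] is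
    then exchanged for one row of [Q], which lowers [k] by one. *)
Lemma right_inverse_completion (R : comUnitRingType) (c r : nat)
    (P : 'M[R]_(c, r)) (N : 'M[R]_(r, c)) :
  local_ring R -> P *m N = 1%:M ->
  exists k (X : 'M[R]_(r, c)) (Y : 'M[R]_(r, k)) (Q : 'M[R]_(k, r)),
    X *m P + Y *m Q = 1%:M /\ (k + c <= r)%N.
Proof.
move=> locR; elim: c => [|c IHc] in P N *.
  move=> _; exists r, 0, 1%:M, 1%:M.
  by rewrite mul0mx add0r mulmx1 addn0.
rewrite -[P](@vsubmxK _ 1 c) -[N](@hsubmxK _ r 1 c).
move: (usubmx _) (dsubmx _) (lsubmx _) (rsubmx _) => q P' n N'.
(* Blockwise, [P *m N = 1] gives [q n = 1], [P' n = 0] and [P' N' = 1]. *)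
rewrite (@mul_col_row _ 1 c r 1 c) (@scalar_mx_block _ 1 c).
case/(@eq_block_mx _ 1 c 1 c) => qn _ P'n P'N'.
have [[|k] [X [Y [Q [XY_1 le_kc]]]]] := IHc _ _ P'N'.
  (* Without completing rows, [X P' = 1] forces [n = X P' n = 0], against [q n = 1]. *)
  have /matrixP/(_ 0 0) := qn; rewrite -(mul1mx n) -XY_1 mulmxDl.
  rewrite -mulmxA P'n mulmx0 add0r (thinmx0 Y) !mul0mx mulmx0 !mxE => /esym/eqP.
  by rewrite oner_eq0.
(* Since [P' n = 0], only the [Q]-part of the expansion of [q] contributes to [q n = 1]. *)
have qYQn : (q *m Y) *m (Q *m n) = 1%:M.
  rewrite -qn -{2}(mul1mx n) -XY_1 mulmxDl -(mulmxA X) P'n mulmx0 add0r.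
  by rewrite !mulmxA.
have [i ui] : exists i, (q *m Y) 0 i \is a GRing.unit.
  have : \sum_i (q *m Y) 0 i * (Q *m n) i 0 \is a GRing.unit.
    by have /matrixP/(_ 0 0) := qYQn; rewrite mxE => ->; rewrite mxE unitr1.
  case/(local_ring_sum_unit _ _ _ locR) => i; rewrite unitrM => /andP[ui _].
  by exists i.
set u := (q *m Y) 0 i in ui.
have q_E : q = q *m X *m P' + u *: row i Q + col' i (q *m Y) *m row' i Q.
  rewrite -{1}(mulmx1 q) -XY_1 mulmxDr !mulmxA (mulmx_split_ord _ _ _ _ i).
  rewrite addrA; congr (_ + _ + _).
  by rewrite [col i _]mx11_scalar mxE mul_scalar_mx.
have Qi_E : row i Q =
    u^-1 *: (q - q *m X *m P' - col' i (q *m Y) *m row' i Q).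
  rewrite {1}q_E addrAC addrK [_ + u *: _]addrC addrK.
  by rewrite scalerA mulVr // scale1r.
(* Substituting [Qi_E] for [row i Q] in [X P' + Y Q = 1] makes [Z] the coefficient of [q]; the other
   two coefficients absorb the corrections. *)
pose Z := u^-1 *: col i Y.
exists k, (row_mx Z (X - Z *m (q *m X))),
  (col' i Y - Z *m col' i (q *m Y)), (row' i Q); split; last by lia.
rewrite (@mul_row_col _ r 1 c r) -XY_1 (mulmx_split_ord _ _ _ _ i Y) Qi_E -scalemxAr.
rewrite scalemxAl -/Z !mulmxBr !mulmxBl !mulmxA.
rewrite -!addrA [RHS]addrCA; do 3!congr (_ + _).
exact: addrC.
Qed.

Section FiniteLocalRing.

Variable R : finComUnitRingType.
Hypothesis locR : local_ring R.

Lemma inner_rank_factor (m n : nat) (M : 'M[R]_(m, n)) :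
  exists (P : 'M[R]_(m, inner_rank M)) (D : 'M[R]_(inner_rank M, n)),
    M = P *m D.
Proof.
rewrite /inner_rank; case: ex_minnP => r /existsP[P /existsP[D /eqP ->]] _.
by exists P, D.
Qed.

Lemma inner_rank_mulmx_le (m r n : nat) (P : 'M[R]_(m, r)) (D : 'M[R]_(r, n)) :
  (inner_rank (P *m D) <= r)%N.
Proof.
rewrite /inner_rank; case: ex_minnP => r' _; apply.
by apply/existsP; exists P; apply/existsP; exists D.
Qed.

(** In a minimal factorization [M = P D], a right inverse [N] of [T M] makes [D N] a right inverse
    of [T P]; complete [T P] and multiply by [D]. *)
Lemma inner_rank_extend (m c n : nat) (M : 'M[R]_(m, n)) (T : 'M[R]_(c, m)) :
  has_right_inverse (T *m M) ->
  exists k (X : 'M[R]_(m, c)) (Y : 'M[R]_(m, k)) (E : 'M[R]_(k, n)),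
    M = X *m (T *m M) + Y *m E /\ (k + c <= inner_rank M)%N.
Proof.
have [P [D defM]] := inner_rank_factor _ _ M.
case/existsP => N /eqP TMN.
have TPDN : (T *m P) *m (D *m N) = 1%:M.
  by rewrite -TMN [in RHS]defM !mulmxA.
have [k [X [Y [Q [XY_1 le_kc]]]]] :=
  right_inverse_completion _ _ _ _ _ locR TPDN.
exists k, (P *m X), (P *m Y), (Q *m D); split=> //.
have -> : T *m M = T *m P *m D by rewrite [in LHS]defM mulmxA.
rewrite [LHS]defM -{1}(mulmx1 P) -XY_1 mulmxDr mulmxDl.
by rewrite !mulmxA.
Qed.

Lemma inner_rank_col_mx_triangle (a b c d n : nat) (A : 'M[R]_(a, n))
    (B : 'M[R]_(b, n)) (C : 'M[R]_(c, n)) (T : 'M[R]_(d, c)) :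
  has_right_inverse (T *m C) ->
  (inner_rank (col_mx A B) + d
     <= inner_rank (col_mx A C) + inner_rank (col_mx C B))%N.
Proof.
move=> invTC.
have TAC : row_mx 0 T *m col_mx A C = T *m C by rewrite mul_row_col mul0mx add0r.
have TCB : row_mx T 0 *m col_mx C B = T *m C by rewrite mul_row_col mul0mx addr0.
have := inner_rank_extend _ _ _ (col_mx A C) (row_mx 0 T).
rewrite TAC => /(_ invTC)[k [X [Y [E [defAC le_k]]]]].
have := inner_rank_extend _ _ _ (col_mx C B) (row_mx T 0).
rewrite TCB => /(_ invTC)[l [Z [W [F [defCB le_l]]]]].
have defA : A = usubmx X *m (T *m C) + usubmx Y *m E.
  by rewrite !mul_usub_mx -raddfD /= -defAC col_mxKu.
have defB : B = dsubmx Z *m (T *m C) + dsubmx W *m F.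
  by rewrite !mul_dsub_mx -raddfD /= -defCB col_mxKd.
(* The block [T *m C] is used by both [A] and [B], so the inner dimension is [d + (k + l)]. *)
have -> : col_mx A B =
    col_mx (row_mx (usubmx X) (row_mx (usubmx Y) 0))
           (row_mx (dsubmx Z) (row_mx 0 (dsubmx W)))
    *m col_mx (T *m C) (col_mx E F).
  by rewrite mul_col_mx !mul_row_col !mul0mx addr0 add0r -defA -defB.
have := inner_rank_mulmx_le _ _ _
  (col_mx (row_mx (usubmx X) (row_mx (usubmx Y) 0))
          (row_mx (dsubmx Z) (row_mx 0 (dsubmx W))))
  (col_mx (T *m C) (col_mx E F)).
lia.
Qed.

Lemma unimodular_dim (n k : nat) (V : {set 'rV[R]_n}) (M : 'M[R]_(k, n)) :
  row_span M = V -> exists T : 'M[R]_(dim V, k), has_right_inverse (T *m M).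
Proof.
move=> spanM; have [S /andP[sSV uS] ->] :
    {S : {set 'rV[R]_n} | (S \subset V) && unimodular S & dim V = #|S|}.
  (* The maximum is attained because the empty family is admissible. *)
  apply: eq_bigmax_cond; apply/card_gt0P; exists set0.
  apply/andP; split; first exact: sub0set.
  apply/existsP; exists 0; apply/eqP.
  by apply/matrixP => -[i lt_i]; exfalso; rewrite cards0 in lt_i.
have SM (i : 'I_#|S|) : exists x : 'rV[R]_k, enum_val i == x *m M.
  have : enum_val i \in row_span M.
    by rewrite spanM (subsetP sSV) ?enum_valP.
  by case/imsetP => x _ ->; exists x.
exists (\matrix_i xchoose (SM i)).
have -> // : (\matrix_i xchoose (SM i)) *m M = \matrix_(i < #|S|) enum_val i.
by apply/row_matrixP => i; rewrite row_mul !rowK -(eqP (xchooseP (SM i))).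
Qed.

Lemma ad_triangle (n : nat) (A B C : subspace R n) :
  dim C = minn (dim A) (dim B) -> ad A B <= ad A C + ad C B.
Proof.
move=> dimC; have /and3P[_ _ /eqP spanC] := subspace_mxP C.
have [T invTC] := unimodular_dim _ _ _ _ spanC.
have := inner_rank_col_mx_triangle _ _ _ _ _
  (subspace_mx A) (subspace_mx B) _ T invTC.
(* As [dim C] is the minimum, the maxima on the right are [dim A] and [dim B], whose sum is
   [maxn (dim A) (dim B) + dim C]. *)
rewrite /ad; move: dimC.
move: (inner_rank _) (inner_rank _) (inner_rank _) (dim A) (dim B) (dim C); lia.
Qed.

End FiniteLocalRing.

Theorem theorem3p8 (p s n : nat) (p_prime : prime p) (s_gt0 : (0 < s)%N)
    (A B C : subspace 'Z_(p ^ s)%N n)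
    (dimC : dim C = minn (dim A) (dim B)) :
  ad A B <= ad A C + ad C B.
Proof. exact: ad_triangle (local_ring_Zp_primeX _ _ p_prime s_gt0) _ _ _ _ dimC. Qed.
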